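(* The primal stability condition and the strict complementary slackness condition (both stated in the context) are not necessary for the certainty equivalent policy to achieve $o(\sqrt T)$ regret: there exist a distribution $F$ and $\mathbf d\in\mathbb R^m_{\ge0}$ such that $(F,\mathbf d)$ violates both conditions and yet, with $\mathbf b=\mathbf dT$, $\mathrm{Reg}_{\mathbf b,T}(\pi^{\mathsf{CE}})=o(\sqrt T)$ as $T\to\infty$.
   Context: Model. There are $m$ resources with initial inventory $\mathbf b\in\mathbb R^m_{\ge0}$ and $T$ periods. Requests $(\mathbf a_t,r_t)$, $t=1,\dots,T$, are i.i.d. with known joint distribution $F$ ($\mathbf a_t\in\mathbb R^m$ is the resource consumption, $r_t$ the reward). In period $t$, after seeing $(\mathbf a_t,r_t)$, a policy $\pi$ irrevocably chooses $x_t^\pi\in\{0,1\}$ (accept $=1$); accepting consumes $\mathbf a_t$ and earns $r_t$, and is feasible only if $\mathbf a_t$ is componentwise at most the remaining inventory. Hindsight regret. $V^{\mathrm{hind}}_{\mathbf b,T}$ is the expectation over $\{(\mathbf a_t,r_t)\}_{t=1}^T$ of the optimal value of the linear program: maximize $\sum_{t=1}^T r_tx_t$ subject to $\sum_{t=1}^T \mathbf a_tx_t\le\mathbf b$, $x_t\in[0,1]$. Then $\mathrm{Reg}_{\mathbf b,T}(\pi)=V^{\mathrm{hind}}_{\mathbf b,T}-\mathbb E[\sum_{t=1}^T r_tx_t^\pi]$. Certainty equivalent (CE) policy $\pi^{\mathsf{CE}}$. Let $\mathbf b_0^{\mathsf{CE}}=\mathbf b$. In period $t$ let $\tilde{\boldsymbol\lambda}_t\in\arg\min_{\boldsymbol\lambda\in\mathbb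 R^m_{\ge0}}\big\{\frac{1}{T-t}(\mathbf b_{t-1}^{\mathsf{CE}})^\top\boldsymbol\lambda+\mathbb E_{(\mathbf a,r)\sim F}[(r-\mathbf a^\top\boldsymbol\lambda)^+]\big\}$, where for $t=T$ one takes $\tilde{\boldsymbol\lambda}_T\in\arg\min_{\boldsymbol\lambda\in\mathbb R^m_{\ge0}}(\mathbf b_{T-1}^{\mathsf{CE}})^\top\boldsymbol\lambda$. Set $x_t^{\mathsf{CE}}=1$ if and only if $r_t\ge\mathbf a_t^\top\tilde{\boldsymbol\lambda}_t$ and $\mathbf a_t\le\mathbf b_{t-1}^{\mathsf{CE}}$ componentwise, and $\mathbf b_t^{\mathsf{CE}}=\mathbf b_{t-1}^{\mathsf{CE}}-x_t^{\mathsf{CE}}\mathbf a_t$. Fluid problems. The primal fluid problem with right-hand side $\mathbf d\in\mathbb R^m_{\ge0}$ is: maximize $\mathbb E_{(\mathbf a,r)\sim F}[r\,x(\mathbf a,r)]$ over (measurable) functions $x(\cdot,\cdot)\in[0,1]$ subject to the resource constraints $\mathbb E_{(\mathbf a,r)\sim F}[\mathbf a\,x(\mathbf a,r)]\le\mathbf d$ componentwise. The dual problem is $\min_{\boldsymbol\lambda\in\mathbb R^m_{\ge0}}f_{\mathbf d}(\boldsymbol\lambda)$ with $f_{\mathbf d}(\boldsymbol\lambda)=\mathbf d^\top\boldsymbol\lambda+\mathbb E_{(\mathbf a,r)\sim F}[(r-\mathbf a^\top\boldsymbol\lambda)^+]$. Primal stability condition for $(F,\mathbf d)$: there exist an optimal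 solution $x^\star_{\mathbf d}$ of the primal fluid problem with right-hand side $\mathbf d$ and a neighborhood $\mathcal N(\mathbf d)$ of $\mathbf d$ such that for every $\mathbf d'\in\mathcal N(\mathbf d)$ there is an optimal solution $x^\star_{\mathbf d'}$ of the primal fluid problem with right-hand side $\mathbf d'$ for which the set of binding resource constraints is the same as that of $x^\star_{\mathbf d}$. Strict complementary slackness condition for $(F,\mathbf d)$ (form for $F$ without point masses): the dual problem has a unique solution $\boldsymbol\lambda^\star$, and for each $i=1,\dots,m$, $\lambda^\star_i=0$ if and only if $d_i-\mathbb E_{(\mathbf a,r)\sim F}[a_i\mathbf 1(r>\mathbf a^\top\boldsymbol\lambda^\star)]>0$. The distribution $F$ in the claim is to be one without point mass (conditional reward CDFs continuous). *)

(* Defs.v *)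
From HB Require Import structures.
From mathcomp Require Import all_boot all_order all_algebra.
From mathcomp Require Import all_classical all_reals all_analysis.

Set Implicit Arguments.
Unset Strict Implicit.
Unset Printing Implicit Defensive.

Import Order.TTheory GRing.Theory Num.Theory.
Import numFieldNormedType.Exports.

Local Open Scope classical_set_scope.
Local Open Scope ring_scope.

(* Row vectors carry the sigma-algebra generated by their coordinates (for    *)
(* real entries, the Borel sigma-algebra), as the library does for tuples.    *)
Definition rV_display : measure_display -> measure_display.
Proof. exact. Qed.

Section measurable_rV.
Context {d} {T : measurableType d} (n : nat).

Let coord (i : 'I_n) (v : 'rV[T]_n) : T := v 0 i.

Let rV_set0 : g_sigma_preimage coord set0.
Proof. exact: sigma_algebra0. Qed.

Let rV_setC A : g_sigma_preimage coord A -> g_sigma_preimage coord (~` A).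
Proof. exact: sigma_algebraC. Qed.

Let rV_bigcup (A : (set 'rV[T]_n)^nat) :
  (forall k, g_sigma_preimage coord (A k)) ->
  g_sigma_preimage coord (\bigcup_k (A k)).
Proof. exact: sigma_algebra_bigcup. Qed.

HB.instance Definition _ := @isMeasurable.Build (rV_display d) 'rV[T]_n
  (g_sigma_preimage coord) rV_set0 rV_setC rV_bigcup.

End measurable_rV.

Section iid_law.
Context {d} {U : measurableType d} {R : realType}.

Definition tuple_cons n (p : U * n.-tuple U) : n.+1.-tuple U :=
  [tuple of p.1 :: p.2].

Lemma measurable_tuple_cons n : measurable_fun setT (@tuple_cons n).
Proof. exact: measurable_cons. Qed.

HB.instance Definition _ n := @isMeasurableFun.Build _ _ _ _
  (@tuple_cons n) (@measurable_tuple_cons n).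

(* The n-fold product of P: the joint law of n i.i.d. draws from P. *)
Fixpoint iid_law (P : probability U R) (n : nat) : probability (n.-tuple U) R :=
  match n with
  | 0 => \d_[tuple]
  | k.+1 => distribution (P \x iid_law P k)%E (@tuple_cons k)
  end.

End iid_law.

Section model.
Context {R : realType} {m : nat}.

Local Notation request := ('rV[R]_m * R)%type.

Implicit Types (F : probability request R) (u v b d lambda : 'rV[R]_m).

Definition dot u v : R := \sum_(i < m) u 0 i * v 0 i.

Definition vle u v : bool := [forall i, u 0 i <= v 0 i].

Definition nonneg v : bool := vle 0 v.

Definition integrable_requests F : Prop :=
  F.-integrable setT (EFin \o (fun q : request => q.2)) /\
  forall i, F.-integrable setT (EFin \o (fun q : request => q.1 0 i)).

(* K is a regular conditional distribution of the reward given the            *)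
(* consumption vector; its distribution functions are continuous.             *)
Definition no_point_mass F : Prop :=
  exists K : R.-pker 'rV[R]_m ~> R,
    (forall (A : set 'rV[R]_m) (B : set R), measurable A -> measurable B ->
       F (A `*` B) = \int[F]_(q in fst @^-1` A) K q.1 B)%E /\
    {ae F, forall q, continuous (fun s : R => fine (K q.1 `]-oo, s]%classic))}.

Definition primal_feasible F d (x : request -> R) : Prop :=
  [/\ measurable_fun setT x,
      forall q, 0 <= x q <= 1 &
      forall i, \int[F]_q (q.1 0 i * x q) <= d 0 i].

Definition primal_optimal F d (x : request -> R) : Prop :=
  primal_feasible F d x /\
  forall y, primal_feasible F d y ->
    \int[F]_q (q.2 * y q) <= \int[F]_q (q.2 * x q).

Definition binding F d (x : request -> R) (i : 'I_m) : Prop :=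
  \int[F]_q (q.1 0 i * x q) = d 0 i.

(* Right-hand sides range over the nonnegative orthant, so the neighborhood   *)
(* is taken relative to it.                                                   *)
Definition primal_stability F d : Prop :=
  exists x, primal_optimal F d x /\
    \forall d' \near d, nonneg d' ->
      exists x', primal_optimal F d' x' /\
        forall i, binding F d' x' i <-> binding F d x i.

Definition is_nonneg_argmin (g : 'rV[R]_m -> R) lambda : Prop :=
  nonneg lambda /\ forall mu, nonneg mu -> g lambda <= g mu.

Definition dual_obj F d lambda : R :=
  dot d lambda + \int[F]_q (Num.max (q.2 - dot q.1 lambda) 0).

Definition strict_complementary_slackness F d : Prop :=
  exists lambda,
    [/\ is_nonneg_argmin (dual_obj F d) lambda,
        forall mu, is_nonneg_argmin (dual_obj F d) mu -> mu = lambda &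
        forall i, lambda 0 i = 0 <->
          0 < d 0 i - \int[F]_q (if dot q.1 lambda < q.2 then q.1 0 i else 0)].

Definition hindsight_feasible T b (w : T.-tuple request)
    (x : 'I_T -> R) : Prop :=
  (forall t, 0 <= x t <= 1) /\
  forall i, \sum_(t < T) (tnth w t).1 0 i * x t <= b 0 i.

Definition hindsight_value T b (w : T.-tuple request) : R :=
  sup [set \sum_(t < T) (tnth w t).2 * x t | x in hindsight_feasible b w].

(* [lam T t b] is the dual price used in period [t] (periods are numbered     *)
(* from 1) of a horizon of length [T] when the remaining inventory is [b].    *)
(* The argmin need not be a singleton: a rule is any measurable selection.    *)
Definition ce_rule F (lam : nat -> nat -> 'rV[R]_m -> 'rV[R]_m) : Prop :=
  forall T t, (0 < t <= T)%N ->
    measurable_fun setT (lam T t) /\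
    forall b, nonneg b ->
      is_nonneg_argmin
        (if (t < T)%N then dual_obj F ((T - t)%:R^-1 *: b) else dot b)
        (lam T t b).

Definition accept lambda b (q : request) : bool :=
  (dot q.1 lambda <= q.2) && vle q.1 b.

(* [ce_inventory lam b w t] is the inventory left after period [t], starting  *)
(* from [b]; the request of period [t.+1] is the entry of index [t] of [w].   *)
Fixpoint ce_inventory T (lam : nat -> nat -> 'rV[R]_m -> 'rV[R]_m) b
    (w : T.-tuple request) (t : nat) : 'rV[R]_m :=
  if t is t'.+1 then
    let b' := ce_inventory lam b w t' in
    let q := nth (0, 0) w t' in
    b' - (accept (lam T t b') b' q)%:R *: q.1
  else b.

Definition ce_action T (lam : nat -> nat -> 'rV[R]_m -> 'rV[R]_m) b
    (w : T.-tuple request) (t : 'I_T) : bool :=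
  let b' := ce_inventory lam b w t in
  accept (lam T t.+1 b') b' (tnth w t).

Definition ce_regret F (lam : nat -> nat -> 'rV[R]_m -> 'rV[R]_m) b
    (T : nat) : R :=
  (\int[iid_law F T]_w hindsight_value b w) -
  \int[iid_law F T]_w (\sum_(t < T) ((tnth w t).2 * (ce_action lam b w t)%:R)).

End model.

(* Main.v *)
From HB Require Import structures.
Require Import Defs.
From mathcomp Require Import all_boot all_order all_algebra.
From mathcomp Require Import all_classical all_reals all_analysis.
From mathcomp Require Import measurable_realfun lra.

Set Implicit Arguments.
Unset Strict Implicit.
Unset Printing Implicit Defensive.

Import Order.TTheory GRing.Theory Num.Theory.
Import numFieldNormedType.Exports.

Local Open Scope classical_set_scope.
Local Open Scope ring_scope.

(** Let every request consume one unit of a single resource, indexed by 0, and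
    earn a reward uniform on [0, 1], and let every capacity be d_i = 1.  Then
    the capacity of resource 0 is exactly the total demand, which is a knife
    edge for both conditions.
    - Accepting everything is the only fluid optimum up to null sets, so the
      constraint of resource 0 binds at d; but demand never exceeds 1, so it is
      slack as soon as d_0 grows, and primal stability fails
      ([unit_law_not_stable]).
    - The price 0 is already optimal for the dual problem, while the slack of
      resource 0 at this price is 1 - 1 = 0, so strict complementary slackness
      fails ([unit_law_not_scs]).

    The certainty equivalent policy is nevertheless optimal on almost every
    sample path.  Suppose that it has accepted the first t requests.  What is
    left of resource 0 is T - t, to be compared with T - t - 1 future periods.
    The ratio exceeds 1, and then every dual minimizer gives price 0 to
    resource 0 ([argmin_slack_price]; in the last period the objective is
    linear and the conclusion immediate), so that request t + 1 is accepted
    too.  The policy thus accepts everything, as does the hindsight optimum,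
    and the regret is 0 for all T ([ce_regret_eq0]), whatever minimizers are
    selected.

    The dual analysis rests on one inequality.  The dual objective is
    d . lambda + g(lambda_0) with g(s) = E[(r - s)^+], and for s in [0, 1] the
    number -P(r > s) = -(1 - s) is a subgradient of g at s
    ([expected_excess_subgradient]).  At s = 0 this gives the uniqueness just
    used; in general it shows that the price max(1 - d_0, 0) is optimal, which
    provides a measurable certainty equivalent rule ([critical_rule_ce]).

    The policy and the hindsight optimum agree only almost surely, and the
    hindsight value is a supremum over an uncountable set, whose measurability
    as a function of the sample is not obvious.  Their expectations are
    therefore compared by [eq_Rintegral_conull], where the integrands are
    arbitrary functions. *)

(** * Integrals of functions that agree outside a null set *)

Section almost_sure.
Context {dT} {T : measurableType dT} {R : realType}.
Variables (mu : {measure set T -> \bar R}) (G : set T).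
Hypotheses (mG : measurable G) (G1 : mu (~` G) = 0%E).

Import HBNNSimple.

(** The integral of a nonnegative function, measurable or not, is a supremum
    over the simple functions below it.  Multiplying such a simple function by
    the indicator of [G] keeps its integral and makes it a lower bound of any
    nonnegative function that agrees with the first one on [G]. *)
Lemma ge0_eq_integral_conull (f g : T -> \bar R) :
  (forall x, 0 <= f x)%E -> (forall x, 0 <= g x)%E ->
  (forall x, G x -> f x = g x) -> (\int[mu]_x f x = \int[mu]_x g x)%E.
Proof.
have le u v : (forall x, 0 <= u x)%E -> (forall x, 0 <= v x)%E ->
    (forall x, G x -> u x = v x) -> (\int[mu]_x u x <= \int[mu]_x v x)%E.
  move=> u0 v0 uv; rewrite !ge0_integralTE//.
  apply: ge_ereal_sup => _ [h /= hu <-].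
  apply: ereal_sup_ubound; exists (proj_nnsfun h mG) => [x|].
    rewrite -mrestrict patchE; case: ifPn => // /set_mem xG.
    by rewrite -uv.
  rewrite -!integralT_nnsfun; apply: ae_eq_integral => //.
  - by apply/measurable_EFinP.
  - by apply/measurable_EFinP.
  exists (~` G); split=> //; first exact: measurableC.
  move=> x + Gx; apply => _.
  by rewrite -mrestrict patchE mem_set.
move=> f0 g0 fg; apply/eqP; rewrite eq_le !le// => x Gx; exact/esym/fg.
Qed.

Lemma eq_integral_conull (f g : T -> \bar R) :
  (forall x, G x -> f x = g x) -> (\int[mu]_x f x = \int[mu]_x g x)%E.
Proof.
move=> fg; rewrite integralE [RHS]integralE.
congr (_ - _)%E; apply: ge0_eq_integral_conull => // x Gx.
  by rewrite funeposE fg // funeposE.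
by rewrite funenegE fg // funenegE.
Qed.

Lemma eq_Rintegral_conull (f g : T -> R) :
  (forall x, G x -> f x = g x) -> \int[mu]_x f x = \int[mu]_x g x.
Proof. by move=> fg; congr fine; apply: eq_integral_conull => x /fg ->. Qed.

Lemma integrable_conull_bounded (f : T -> R) (M : R) :
  (mu setT < +oo)%E -> measurable_fun setT f ->
  (forall x, G x -> `|f x| <= M) -> mu.-integrable setT (EFin \o f).
Proof.
move=> mufin mf fM; apply/integrableP; split; first exact/measurable_EFinP.
rewrite (eq_integral_conull (g := fun x => (Num.min `|f x| `|M|)%:E)).
  apply: (@le_lt_trans _ _ (\int[mu]_x (cst `|M|%:E x))%E).
    apply: ge0_le_integral => //.
    - apply/measurable_EFinP; apply: measurable_minr => //.
      exact: measurableT_comp.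
    - by move=> x _; rewrite lee_fin ge_min lexx orbT.
  by rewrite integral_cst// lte_mul_pinfty// ?lee_fin.
by move=> x Gx /=; rewrite min_l// (le_trans (fM _ Gx))// ler_norm.
Qed.

End almost_sure.

(** * Measurability of row vectors *)

Section row_vectors.
Context {dT} {T : measurableType dT} {dU} {U : measurableType dU} (n : nat).

Lemma measurable_coord (i : 'I_n) :
  measurable_fun setT (fun v : 'rV[T]_n => v 0 i).
Proof.
move=> _ Y mY; rewrite setTI; apply: sub_sigma_algebra => /=.
rewrite -bigcup_seq/=; exists i => /=; first by rewrite mem_index_enum.
by exists Y => //; rewrite setTI.
Qed.

(** The sets with a measurable preimage form a sigma-algebra that contains the
    generators of the one on row vectors. *)
Lemma measurable_fun_rV (f : U -> 'rV[T]_n) :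
  (forall i, measurable_fun setT (fun u => f u 0 i)) -> measurable_fun setT f.
Proof.
move=> mf _ A mA; rewrite setTI.
pose S := [set B : set 'rV[T]_n | measurable (f @^-1` B)].
suff : S A by [].
apply: mA => /=; split.
- split => [|B SB|B SB]; rewrite /S/=.
  + by rewrite preimage_set0.
  + by rewrite setTD preimage_setC; exact: measurableC.
  + by rewrite preimage_bigcup; exact: bigcupT_measurable.
- rewrite -bigcup_seq => B [i _ [Y mY <-]].
  by rewrite /S/= setTI; have := mf i measurableT _ mY; rewrite setTI.
Qed.

End row_vectors.

(** * Almost sure properties of i.i.d. samples *)

Section iid.
Context {dT} {U : measurableType dT} {R : realType}.
Variables (P : probability U R) (G : set U).
Hypothesis (mG : measurable G).

Lemma measurable_all_tnth n :
  measurable [set w : n.-tuple U | forall i, G (tnth w i)].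
Proof.
rewrite (_ : [set _ | _] =
    \bigcap_(i in [set: 'I_n]) ((fun w => tnth w i) @^-1` G)).
  apply: fin_bigcap_measurable => // i _.
  by rewrite -[X in measurable X]setTI; exact: measurable_tnth.
by apply/seteqP; split => w /= Gw i => [_|]; [exact: Gw|exact: (Gw i)].
Qed.

Lemma iid_law_all n :
  P (~` G) = 0%E -> iid_law P n (~` [set w | forall i, G (tnth w i)]) = 0%E.
Proof.
move=> G1.
have PG : P G = 1%E.
  by rewrite -[G]setCK probability_setC ?G1 ?sube0//; exact: measurableC.
rewrite probability_setC; last exact: measurable_all_tnth.
suff -> : iid_law P n [set w | forall i, G (tnth w i)] = 1%E by rewrite subee.
elim: n => [|n IHn] /=.
  by rewrite diracE mem_set// => -[].
rewrite /distribution /pushforward (_ : _ @^-1` _ =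
    G `*` [set w : n.-tuple U | forall i, G (tnth w i)]).
  rewrite product_measure1E//; last exact: measurable_all_tnth.
  by rewrite [X in (X * _)%E]PG [X in (_ * X)%E]IHn mule1.
apply/seteqP; split => [[q w] /= Gw|[q w] /= [Gq Gw] i].
  split; first by have := Gw ord0.
  by move=> i; have := Gw (lift ord0 i); rewrite tnthS.
have [->|i0] := eqVneq i ord0; first by [].
have [j ->] : exists j, i = lift ord0 j.
  by case: (unliftP ord0 i) => [j ->|/eqP]; [exists j|rewrite (negbTE i0)].
by rewrite tnthS.
Qed.

End iid.

(** * The uniform distribution on the unit interval *)

Section unit_uniform.
Context {R : realType}.

(** [measurableTypeR R], which carries the uniform distribution, has the same
    measurable sets as [R] but another display; pushing the distribution
    forward by the identity moves it to [R]. *)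
Let borelR : measurableTypeR R -> R := idfun.

Let measurable_borelR : measurable_fun setT borelR.
Proof. exact: measurable_id. Qed.

HB.instance Definition _ := @isMeasurableFun.Build _ _ _ _
  borelR measurable_borelR.

Definition unit_uniform : probability R R :=
  distribution (uniform_prob (@ltr01 R)) borelR.

Lemma unit_uniformE (A : set R) : measurable A ->
  unit_uniform A = lebesgue_measure (A `&` `[0, 1]%classic).
Proof.
move=> mA; rewrite /unit_uniform/= /uniform_prob integral_uniform_pdf.
rewrite (eq_integral (cst 1%E)); last first.
  move=> x; rewrite inE/= in_itv/= => -[_ x01].
  by rewrite /uniform_pdf x01 subr0 invr1.
by rewrite integral_cst ?mul1e//; exact: measurableI.
Qed.

Lemma unit_uniform_le (s : R) :
  unit_uniform `]-oo, s]%classic = (Num.max 0 (Num.min s 1))%:E.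
Proof.
rewrite unit_uniformE//.
have [s0|s0] := ltP s 0.
  rewrite (_ : _ `&` _ = set0) ?measure0.
    by rewrite max_l// ge_min (ltW s0).
  apply/seteqP; split => x //=; rewrite !in_itv/= => -[xs /andP[x0 _]].
  by move: s0; rewrite ltNge (le_trans x0 xs).
have m0 : 0 <= Num.min s 1 by rewrite le_min s0 ler01.
rewrite (_ : _ `&` _ = `[0, Num.min s 1]%classic).
  rewrite lebesgue_measure_itv/= lte_fin max_r//; case: ifPn => [_|].
    by rewrite oppr0 adde0.
  by rewrite -leNgt => m0'; congr EFin; apply/eqP; rewrite eq_le m0 m0'.
apply/seteqP; split => x /=; rewrite !in_itv/= le_min.
  by move=> [-> /andP[-> ->]].
by move=> /andP[-> /andP[-> ->]].
Qed.

Lemma unit_uniform_gt (s : R) : 0 <= s <= 1 ->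
  unit_uniform `]s, +oo[%classic = (1 - s)%:E.
Proof.
move=> /andP[s0 s1]; rewrite -setCitvl probability_setC//.
by rewrite unit_uniform_le min_l// max_r.
Qed.

End unit_uniform.

(** * The law of the requests *)

Section instance.
Context {R : realType} {m : nat}.

Local Notation request := ('rV[R]_m.+1 * R)%type.

Implicit Types (b d lambda mu v : 'rV[R]_m.+1).

Definition e0 : 'rV[R]_m.+1 := delta_mx 0 0.

Lemma e0E i : e0 0 i = (i == 0)%:R.
Proof. by rewrite mxE eqxx. Qed.

Lemma dot_e0l v : dot e0 v = v 0 0.
Proof.
rewrite /dot big_ord_recl/= e0E mul1r big1 ?addr0// => i _.
by rewrite e0E mul0r.
Qed.

Lemma dot_e0r v s : dot v (s *: e0) = v 0 0 * s.
Proof.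
rewrite /dot big_ord_recl/= mxE e0E mulr1 big1 ?addr0// => i _.
by rewrite mxE e0E !mulr0.
Qed.

Lemma nonnegP v : reflect (forall i, 0 <= v 0 i) (nonneg v).
Proof. by apply: (iffP forallP) => v0 i; move: (v0 i); rewrite mxE. Qed.

Definition unit_request (r : R) : request := (e0, r).

Lemma measurable_unit_request : measurable_fun setT unit_request.
Proof. exact: pair1_measurable. Qed.

HB.instance Definition _ := @isMeasurableFun.Build _ _ _ _
  unit_request measurable_unit_request.

Definition unit_law : probability request R :=
  distribution unit_uniform unit_request.

(** The reward 0 is left out because a fluid optimum and the demand at price 0
    are determined only where the reward is positive. *)
Definition typical : set request :=
  [set q | q.1 = e0 /\ 0 < q.2 <= 1].

Lemma measurable_eq_e0 : measurable [set e0].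
Proof.
rewrite (_ : [set e0] =
    \bigcap_(i in [set: 'I_m.+1]) ((fun v => v 0 i) @^-1` [set e0 0 i])).
  apply: fin_bigcap_measurable => // i _.
  by rewrite -[X in measurable X]setTI; exact: measurable_coord.
apply/seteqP; split => [v /= -> //|v /= ve].
by apply/rowP => i; exact: ve.
Qed.

Lemma measurable_typical : measurable typical.
Proof.
rewrite (_ : typical = [set e0] `*` `]0, 1]%classic).
  by apply: measurableX => //; exact: measurable_eq_e0.
by apply/seteqP; split => q /=; rewrite in_itv.
Qed.

Lemma unit_law_typical : unit_law (~` typical) = 0%E.
Proof.
have mt := measurable_typical.
rewrite probability_setC//= /distribution /pushforward.
rewrite (_ : _ @^-1` _ = `]0, 1]%classic); last first.
  by apply/seteqP; split => r /=; rewrite in_itv/=; [move=> []|split].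
rewrite unit_uniformE// setIidl.
  by rewrite lebesgue_measure_itv/= lte01 oppr0 adde0 subee.
by move=> x; rewrite /= !in_itv/= => /andP[/ltW -> ->].
Qed.

(** Only the rewards in ]0, 1] matter: the other requests form a null set. *)
Lemma unit_law_integrable (f : request -> R) M :
  measurable_fun setT f -> (forall r, 0 < r <= 1 -> `|f (e0, r)| <= M) ->
  unit_law.-integrable setT (EFin \o f).
Proof.
move=> mf fM; apply: (integrable_conull_bounded (M := M)
  measurable_typical unit_law_typical) => //.
  by rewrite [X in (X < _)%E]probability_setT ltry.
by move=> [a r] [/= -> r01]; exact: fM.
Qed.

Lemma eq_unit_law_Rintegral (f g : request -> R) :
  (forall r, 0 < r <= 1 -> f (e0, r) = g (e0, r)) ->
  \int[unit_law]_q f q = \int[unit_law]_q g q.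
Proof.
move=> fg; apply: (eq_Rintegral_conull
  measurable_typical unit_law_typical) => -[a r] [/= -> r01].
exact: fg.
Qed.

Lemma le_unit_law_Rintegral (f g : request -> R) M N :
  measurable_fun setT f -> measurable_fun setT g ->
  (forall r, 0 < r <= 1 -> `|f (e0, r)| <= M) ->
  (forall r, 0 < r <= 1 -> `|g (e0, r)| <= N) ->
  (forall r, 0 < r <= 1 -> f (e0, r) <= g (e0, r)) ->
  \int[unit_law]_q f q <= \int[unit_law]_q g q.
Proof.
move=> mf mg fM gN fg.
(* [f \min g] is below [g] everywhere, as monotonicity of integrals requires. *)
rewrite (@eq_unit_law_Rintegral f (f \min g)); last first.
  by move=> r /fg fgr /=; rewrite min_l.
apply: le_Rintegral => //.
- apply: (unit_law_integrable (M := M)); first exact: measurable_minr.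
  by move=> r r01 /=; rewrite min_l ?fM ?fg.
- exact: unit_law_integrable gN.
- by move=> q _ /=; rewrite ge_min lexx orbT.
Qed.

Lemma Rintegral_unit_law_cst c : \int[unit_law]_q c = c.
Proof. by rewrite Rintegral_cst// [X in fine X]probability_setT mulr1. Qed.

Lemma unit_law_reward_gt s : 0 <= s <= 1 ->
  \int[unit_law]_q (s < q.2)%R%:R = 1 - s.
Proof.
move=> s01; pose A := [set: 'rV[R]_m.+1] `*` `]s, +oo[%classic.
have mA : measurable A by exact: measurableX.
rewrite (@eq_Rintegral _ _ _ _ _ \1_A); last first.
  move=> q _; rewrite indicE; congr (_%:R); congr nat_of_bool.
  by apply/idP/idP => [h|/set_mem[_]]; [apply/mem_set; split|];
    rewrite //= in_itv/= andbT.
rewrite /Rintegral integral_indic// setIT /= /distribution /pushforward.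
rewrite (_ : _ @^-1` _ = `]s, +oo[%classic) ?unit_uniform_gt//.
by apply/seteqP; split => r //= [].
Qed.

Lemma measurable_request_coord i :
  measurable_fun setT (fun q : request => q.1 0 i).
Proof.
apply: (@measurableT_comp _ _ _ _ _ _ (fun v : 'rV[R]_m.+1 => v 0 i)).
  exact: measurable_coord.
exact: measurable_fst.
Qed.

Lemma unit_law_integrable_requests : integrable_requests unit_law.
Proof.
split.
  apply: (unit_law_integrable (M := 1)); first exact: measurable_snd.
  by move=> r /andP[r0 r1]; rewrite /= gtr0_norm.
move=> i; apply: (unit_law_integrable (M := 1)).
  exact: measurable_request_coord.
by move=> r _; rewrite /= e0E ger0_norm// lern1; case: eqP.
Qed.

(** The reward is independent of the consumption, so its conditional law is
    the uniform law whatever the consumption. *)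
Definition unit_kernel : 'rV[R]_m.+1 -> pprobability R R :=
  fun=> unit_uniform.

Lemma unit_law_no_point_mass : no_point_mass unit_law.
Proof.
have mK : measurable_fun setT unit_kernel by exact: measurable_cst.
exists (kprobability mK); split => [A B mA mB|].
  rewrite /kprobability integral_cst; last first.
    by rewrite -[X in measurable X]setTI; exact: measurable_fst.
  rewrite /= /distribution /pushforward.
  have [eA|eA] := pselect (A e0).
    have -> : unit_request @^-1` (A `*` B) = B.
      by apply/seteqP; split => r //= [].
    have -> : unit_request @^-1` (fst @^-1` A) = setT by apply/seteqP; split.
    by rewrite [X in (_ * X)%E]probability_setT mule1.
  have -> : unit_request @^-1` (A `*` B) = set0.
    by apply/seteqP; split => r //= [].
  have -> : unit_request @^-1` (fst @^-1` A) = set0 by apply/seteqP; split.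
  by rewrite !measure0 mule0.
apply: aeW => q.
rewrite (_ : (fun s => _) = (fun s : R => Num.max 0 (Num.min s 1))).
  have : continuous (cst 0 \max (idfun \min cst 1) : R -> R).
    move=> s; apply: continuous_max; first exact: cst_continuous.
    by apply: continuous_min; [exact: cvg_id|exact: cst_continuous].
  exact.
apply/funext => s.
rewrite [X in fine X](_ : _ = unit_uniform `]-oo, s]%classic)//.
by rewrite unit_uniform_le.
Qed.

(** * The dual problem *)

Lemma measurable_excess s :
  measurable_fun setT (fun q : request => Num.max (q.2 - s) 0).
Proof.
by apply: measurable_maxr => //; exact: measurable_funB.
Qed.

Definition expected_excess (s : R) : R :=
  \int[unit_law]_q Num.max (q.2 - s) 0.

Lemma excess_bounded (s r : R) : 0 <= s -> 0 < r <= 1 ->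
  `|Num.max (r - s) 0| <= 1.
Proof.
move=> s0 /andP[r0 r1]; rewrite ger0_norm ?le_max ?lexx ?orbT//.
by rewrite ge_max ler01 andbT lerBlDr (le_trans r1)// lerDl.
Qed.

Lemma dual_objE d lambda :
  dual_obj unit_law d lambda = dot d lambda + expected_excess (lambda 0 0).
Proof.
congr (_ + _); apply: eq_unit_law_Rintegral => r _ /=.
by rewrite dot_e0l.
Qed.

(** The convex function u |-> (r - u)^+ has the subgradient -1(r > s) at s;
    take expectations. *)
Lemma expected_excess_subgradient s t : 0 <= s <= 1 -> 0 <= t ->
  expected_excess s - (1 - s) * (t - s) <= expected_excess t.
Proof.
move=> s01 t0; have [s0 s1] := andP s01.
pose g (q : request) : R := (s < q.2)%R%:R.
have mg : measurable_fun setT g.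
  rewrite (_ : g = fun q => if s < q.2 then 1 else 0); last first.
    by apply/funext => q; rewrite /g; case: ltP.
  by apply: measurable_fun_ifT => //; apply: measurable_fun_ltr.
have ge : unit_law.-integrable setT (EFin \o g).
  apply: (unit_law_integrable (M := 1)) => // r _.
  by rewrite /g ger0_norm// lern1; case: (_ < _).
have igc c : unit_law.-integrable setT (EFin \o (fun q => g q * c)).
  apply: (unit_law_integrable (M := `|c|)); first exact: measurable_funM.
  by move=> r _; rewrite /g; case: (_ < _); rewrite ?mul1r// mul0r normr0.
have ie u : 0 <= u -> unit_law.-integrable setT
    (EFin \o (fun q : request => Num.max (q.2 - u) 0)).
  move=> u0; apply: (unit_law_integrable (M := 1)).
    exact: measurable_excess.
  by move=> r; exact: excess_bounded.
rewrite -unit_law_reward_gt// -RintegralZr//.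
rewrite -[X in X <= _](RintegralB measurableT (ie _ s0) (igc _)).
apply: le_Rintegral; [exact: measurableT| | exact: ie |].
  exact: (integrableB measurableT (ie _ s0) (igc _)).
move=> q _; rewrite /g; case: ltP => sq.
  have -> : Num.max (q.2 - s) 0 = q.2 - s by apply: max_l; lra.
  by rewrite mul1r le_max; apply/orP; left; lra.
have -> : Num.max (q.2 - s) 0 = 0 by apply: max_r; lra.
by rewrite mul0r subr0 le_max lexx orbT.
Qed.

(** The price of resource 0 at which the expected demand P(r > s) = 1 - s
    equals its capacity, or 0 if the capacity is at least 1. *)
Definition critical_price b : R := Num.max (1 - b 0 0) 0.

Lemma le_dot_coord0 b mu : nonneg b -> nonneg mu -> b 0 0 * mu 0 0 <= dot b mu.
Proof.
move=> /nonnegP b0 /nonnegP mu0; rewrite /dot big_ord_recl lerDl.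
by apply: sumr_ge0 => i _; rewrite mulr_ge0.
Qed.

Lemma critical_price_argmin b : nonneg b ->
  is_nonneg_argmin (dual_obj unit_law b) (critical_price b *: e0).
Proof.
move=> b0; have b00 := nonnegP _ b0 0.
have p01 : 0 <= critical_price b <= 1.
  by rewrite le_max lexx orbT ge_max ler01 andbT lerBlDr lerDl.
have [p0 p1] := andP p01.
split; first by apply/nonnegP => i; rewrite mxE e0E mulr_ge0.
move=> mu mu0; have mu00 := nonnegP _ mu0 0.
rewrite !dual_objE dot_e0r mxE e0E mulr1.
have := expected_excess_subgradient p01 mu00.
have := le_dot_coord0 b0 mu0.
have : 0 <= (b 0 0 - (1 - critical_price b)) * (mu 0 0 - critical_price b).
  (* Either the price is 0 and the first factor is nonnegative, or demand meets
     capacity and the first factor vanishes. *)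
  rewrite /critical_price; have [b1|b1] := leP (1 - b 0 0) 0.
    by rewrite !subr0 mulr_ge0//; lra.
  by rewrite [X in X * _](_ : _ = 0) ?mul0r//; lra.
by lra.
Qed.

(** Raising the price of resource 0 from 0 costs at least [b 0 0] per unit in
    the linear term, and saves at most P(r > 0) = 1 in the other one. *)
Lemma argmin_slack_price b lambda : nonneg b -> 1 < b 0 0 ->
  is_nonneg_argmin (dual_obj unit_law b) lambda -> lambda 0 0 = 0.
Proof.
move=> b0 b1 [l0 /(_ 0)]; have l00 := nonnegP _ l0 0.
have n0 : nonneg (0 : 'rV[R]_m.+1) by apply/nonnegP => i; rewrite mxE.
move=> /(_ n0); rewrite !dual_objE mxE.
have -> : dot b 0 = 0 by rewrite /dot big1// => i _; rewrite mxE mulr0.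
have z01 : 0 <= (0 : R) <= 1 by rewrite lexx ler01.
have := expected_excess_subgradient z01 l00.
have := le_dot_coord0 b0 l0.
move=> h1 h2 h3; apply/eqP; rewrite eq_le l00 andbT.
rewrite -(pmulr_rle0 _ (x := b 0 0 - 1)).
  by lra.
by rewrite subr_gt0.
Qed.

(** * Failure of both conditions *)

Definition ones : 'rV[R]_m.+1 := const_mx 1.

Lemma ones_nonneg : nonneg ones.
Proof. by apply/nonnegP => i; rewrite mxE. Qed.

Lemma unit_law_not_scs : ~ strict_complementary_slackness unit_law ones.
Proof.
move=> [lambda [_ uniq slack]].
have l00 : lambda 0 0 = 0.
  rewrite -(uniq _ (critical_price_argmin ones_nonneg)) mxE.
  by rewrite /critical_price mxE subrr maxxx mul0r.
have := (slack 0).1 l00; rewrite mxE (@eq_unit_law_Rintegral _ (cst 1)).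
  by rewrite Rintegral_unit_law_cst subrr ltxx.
by move=> r /andP[r0 _] /=; rewrite dot_e0l l00 r0 e0E.
Qed.

(** Accepting everything is feasible, so an optimal [x] loses nothing against
    it: the integrand r (1 - x) >= 0 has integral 0, hence x = 1 almost surely
    because r > 0. *)
Lemma primal_optimal_ones_binding x :
  primal_optimal unit_law ones x -> binding unit_law ones x 0.
Proof.
move=> [[mx x01 _] xopt].
have : primal_feasible unit_law ones (cst 1).
  split => // [q|i]; first by rewrite /= ler01 lexx.
  rewrite (@eq_unit_law_Rintegral _ (cst (i == 0)%:R)).
    by rewrite Rintegral_unit_law_cst mxE lern1; case: eqP.
  by move=> r _; rewrite /= mulr1 e0E.
move=> /xopt le.
pose loss (q : request) : R := q.2 * 1 - q.2 * x q.
have bx (r : R) : 0 < r <= 1 -> `|r * x (e0, r)| <= 1.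
  move=> /andP[r0 r1]; have /andP[x0 x1] := x01 (e0, r).
  by rewrite ger0_norm ?mulr_ge0 ?mulr_ile1// ltW.
have b1 (r : R) : 0 < r <= 1 -> `|r * 1| <= 1.
  by move=> /andP[r0 r1]; rewrite mulr1 gtr0_norm.
have mrx : measurable_fun setT (fun q : request => q.2 * x q).
  exact: measurable_funM.
have mr1 : measurable_fun setT (fun q : request => q.2 * 1).
  exact: measurable_funM.
have irx := unit_law_integrable mrx bx.
have ir1 := unit_law_integrable mr1 b1.
have mloss : measurable_fun setT loss by exact: measurable_funB.
have loss0 : (\int[unit_law]_q `|(loss q)%:E| = 0)%E.
  rewrite (eq_integral_conull measurable_typical unit_law_typical
    (g := fun q => (loss q)%:E)).
    have iloss : unit_law.-integrable setT (EFin \o loss).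
      exact: (integrableB measurableT ir1 irx).
    rewrite -[LHS]fineK; last exact: integrable_fin_num.
    congr EFin; apply/eqP; rewrite eq_le; apply/andP; split.
      have := RintegralB measurableT ir1 irx; rewrite /Rintegral => ->.
      by rewrite subr_le0.
    apply: (@le_trans _ _ (\int[unit_law]_q (cst 0 : request -> R) q)).
      by rewrite Rintegral_unit_law_cst.
    rewrite (_ : fine _ = \int[unit_law]_q loss q)//.
    apply: (@le_unit_law_Rintegral _ _ 0 1) => //.
    - by move=> r _ /=; rewrite normr0.
    - move=> r /andP[r0 r1]; have /andP[x0 x1] := x01 (e0, r).
      by rewrite /loss /= -mulrBr ger0_norm ?mulr_ge0 ?mulr_ile1//; lra.
    - move=> r /andP[r0 r1]; have /andP[x0 x1] := x01 (e0, r).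
      by rewrite /loss /= -mulrBr mulr_ge0//; lra.
  move=> [a r] [/= -> /andP[r0 r1]]; have /andP[x0 x1] := x01 (e0, r).
  by rewrite /loss /= -mulrBr ger0_norm// mulr_ge0//; lra.
have /ae_eq_integral_abs : measurable_fun setT (EFin \o loss).
  exact/measurable_EFinP.
move=> /(_ unit_law measurableT)[+ _] => /(_ loss0)[N [mN N0 subN]].
rewrite /binding mxE -[RHS]Rintegral_unit_law_cst.
apply: (@eq_Rintegral_conull _ _ _ _ (typical `&` ~` N)).
- by apply: measurableI; [exact: measurable_typical|exact: measurableC].
- rewrite setCI setCK; apply: null_set_setU => //.
  + by apply: measurableC; exact: measurable_typical.
  + exact: unit_law_typical.
- move=> [a r] [[/= -> /andP[r0 r1]] Nr]; rewrite e0E mul1r.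
  have : loss (e0, r) = 0.
    apply: contrapT => h; apply: Nr; apply: subN => /= /(_ I) [].
    exact: h.
  rewrite /loss /= -mulrBr => /eqP; rewrite mulf_eq0 gt_eqF//=.
  by rewrite subr_eq0 => /eqP.
Qed.

(** Raising the capacity of resource 0 by eps / 2 stays in the neighborhood,
    but the expected demand is at most 1, so the constraint no longer binds. *)
Lemma unit_law_not_stable : ~ primal_stability unit_law ones.
Proof.
move=> [x [xopt]] /nbhs_ballP[eps /= eps0 stab].
pose d' : 'rV[R]_m.+1 := ones + (eps / 2) *: e0.
have d'E i : d' 0 i = 1 + eps / 2 * (i == 0)%:R by rewrite !mxE eqxx.
have h2 : 0 < eps / 2 by rewrite divr_gt0.
have d'0 : nonneg d'.
  by apply/nonnegP => i; rewrite d'E addr_ge0// mulr_ge0// ltW.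
have /stab /(_ d'0)[x' [[[mx' x'01 _] _] /(_ 0)[_ bind]]] : ball ones eps d'.
  split=> // i j; rewrite ord1 /ball /= d'E mxE opprD addNKr normrN.
  rewrite ger0_norm; last by rewrite mulr_ge0// ltW.
  case: eqP => _; rewrite ?mulr1 ?mulr0//.
  by rewrite ltr_pdivrMr// ltr_pMr// ltr1n.
have := bind (primal_optimal_ones_binding xopt); rewrite /binding d'E mulr1.
have : \int[unit_law]_q (q.1 0 0 * x' q) <=
       \int[unit_law]_q (cst 1 : request -> R) q.
  apply: (@le_unit_law_Rintegral _ _ 1 1) => //.
  - by apply: measurable_funM => //; exact: measurable_request_coord.
  - move=> r _; have /andP[x0 x1] := x'01 (e0, r).
    by rewrite /= e0E mul1r ger0_norm.
  - by move=> r _; rewrite /= normr1.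
  - move=> r _; have /andP[x0 x1] := x'01 (e0, r).
    by rewrite /= e0E mul1r.
by rewrite Rintegral_unit_law_cst => + h; rewrite h gerDl leNgt h2.
Qed.

(** * A measurable certainty equivalent rule *)

Definition critical_rule (T t : nat) b : 'rV[R]_m.+1 :=
  if (t < T)%N then critical_price ((T - t)%:R^-1 *: b) *: e0 else 0.

Lemma critical_rule_ce : ce_rule unit_law critical_rule.
Proof.
move=> T t tT; rewrite /critical_rule; case: (ltnP t T) => _; split.
- apply: measurable_fun_rV => i.
  rewrite (_ : (fun b => _) =
      fun b => Num.max (1 - (T - t)%:R^-1 * b 0 0) 0 * (i == 0)%:R).
    apply: measurable_funM => //; apply: measurable_maxr => //.
    apply: measurable_funB => //; apply: measurable_funM => //.
    exact: measurable_coord.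
  by apply/funext => b; rewrite mxE e0E /critical_price mxE.
- move=> b /nonnegP b0; apply: critical_price_argmin.
  by apply/nonnegP => i; rewrite mxE mulr_ge0// invr_ge0 ler0n.
- exact: measurable_cst.
- move=> b b0; have z0 : nonneg (0 : 'rV[R]_m.+1).
    by apply/nonnegP => i; rewrite mxE.
  split => // mu mu0; rewrite [leLHS]/dot big1 => [|i _]; last first.
    by rewrite mxE mulr0.
  by apply: sumr_ge0 => i _; rewrite mulr_ge0//; exact: nonnegP.
Qed.

(** * The regret vanishes *)

Section accept_all.
Variables (T : nat) (lam : nat -> nat -> 'rV[R]_m.+1 -> 'rV[R]_m.+1).
Hypothesis (ce : ce_rule unit_law lam).
Variable w : T.-tuple request.
Hypothesis (tw : forall t, typical (tnth w t)).

(** The inventory after [t] periods in which everything was accepted. *)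
Definition stock (t : nat) : 'rV[R]_m.+1 := T%:R *: ones - t%:R *: e0.

Lemma stockE t i : stock t 0 i = T%:R - t%:R * (i == 0)%:R.
Proof. by rewrite !mxE eqxx mulr1. Qed.

Lemma stock_nonneg t : (t <= T)%N -> nonneg (stock t).
Proof.
move=> tT; apply/nonnegP => i; rewrite stockE subr_ge0.
by case: eqP => _; rewrite ?mulr1 ?mulr0 ?ler0n// ler_nat.
Qed.

(** In period [t.+1] the stock T - t of resource 0 exceeds the T - t - 1
    periods to come.  In the last period the objective is the linear function
    b . lambda, where b_0 = 1 > 0 forces the same conclusion. *)
Lemma price_stock0 t : (t < T)%N -> lam T t.+1 (stock t) 0 0 = 0.
Proof.
move=> tT; have [_ /(_ _ (stock_nonneg (ltnW tT)))] := @ce T t.+1 tT.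
have st0 : stock t 0 0 = (T - t)%:R by rewrite stockE mulr1 natrB// ltnW.
case: ifPn => [t1T|].
  apply: argmin_slack_price.
    apply/nonnegP => i; rewrite mxE mulr_ge0 ?invr_ge0//.
    by have /nonnegP := stock_nonneg (ltnW tT).
  rewrite mxE st0 mulrC ltr_pdivlMr ?ltr0n ?subn_gt0// mul1r ltr_nat.
  by rewrite ltn_sub2l.
move=> _ [l0 /(_ 0)]; have z0 : nonneg (0 : 'rV[R]_m.+1).
  by apply/nonnegP => i; rewrite mxE.
move=> /(_ z0); rewrite [leRHS]/dot big1 => [|i _]; last first.
  by rewrite [X in _ * X]mxE mulr0.
have := le_dot_coord0 (stock_nonneg (ltnW tT)) l0.
move=> /le_trans/[apply]; rewrite st0 pmulr_rle0 ?ltr0n ?subn_gt0// => l00.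
by apply/eqP; rewrite eq_le l00; move/nonnegP : l0; exact.
Qed.

Lemma accept_stock t q : (t < T)%N -> typical q ->
  accept (lam T t.+1 (stock t)) (stock t) q.
Proof.
move=> tT [qe /andP[q0 _]]; rewrite /accept qe dot_e0l price_stock0// ltW//=.
apply/forallP => i; rewrite stockE e0E; case: eqP => _.
  by rewrite mulr1 -natrB ?(ltnW tT)// ler1n subn_gt0.
by rewrite mulr0 subr0 ler0n.
Qed.

Lemma inventory_stock t : (t <= T)%N ->
  ce_inventory lam (T%:R *: ones) w t = stock t.
Proof.
elim: t => [_|t IHt tT] /=; first by rewrite /stock scale0r subr0.
rewrite (IHt (ltnW tT)).
have tq : typical (nth (0, 0) w t) by rewrite -(tnth_nth _ w (Ordinal tT)).
rewrite accept_stock// scale1r; case: tq => -> _.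
by rewrite /stock -addrA -opprD -natr1 scalerDl scale1r.
Qed.

Lemma ce_action_true t : ce_action lam (T%:R *: ones) w t.
Proof.
by rewrite /ce_action inventory_stock ?accept_stock// ltnW.
Qed.

Lemma hindsight_all :
  hindsight_value (T%:R *: ones) w = \sum_(t < T) (tnth w t).2.
Proof.
rewrite /hindsight_value; set S := [set _ | _ in _].
have r0 t : 0 <= (tnth w t).2 by have [_ /andP[/ltW]] := tw t.
have ub : ubound S (\sum_(t < T) (tnth w t).2).
  move=> _ [x [x01 _] <-]; apply: ler_sum => t _.
  by apply: ler_piMr => //; have /andP[] := x01 t.
have inS : S (\sum_(t < T) (tnth w t).2).
  exists (fun=> 1); last by apply: eq_bigr => t _; rewrite mulr1.
  split=> [t|i]; first by rewrite ler01 lexx.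
  rewrite (eq_bigr (fun=> (i == 0)%:R)) => [|t _]; last first.
    by have [-> _] := tw t; rewrite e0E mulr1.
  rewrite sumr_const card_ord !mxE mulr1 -[leLHS]mulr_natl ler_piMr//.
  by rewrite lern1; case: eqP.
apply/eqP; rewrite eq_le; apply/andP; split.
  by apply: ge_sup ub; exists (\sum_(t < T) (tnth w t).2).
by apply: ub_le_sup inS; exists (\sum_(t < T) (tnth w t).2).
Qed.

End accept_all.

Lemma ce_regret_eq0 lam T : ce_rule unit_law lam ->
  ce_regret unit_law lam (T%:R *: ones) T = 0.
Proof.
move=> ce; rewrite /ce_regret; apply/eqP; rewrite subr_eq0; apply/eqP.
apply: (@eq_Rintegral_conull _ _ _ _ [set w | forall t, typical (tnth w t)]).
- apply: measurable_all_tnth; exact: measurable_typical.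
- exact: (iid_law_all measurable_typical T unit_law_typical).
move=> w tw; rewrite hindsight_all//; apply: eq_bigr => t _.
by rewrite ce_action_true// mulr1.
Qed.

End instance.

Theorem corollary4p2 (R : realType) (m : nat) : (0 < m)%N ->
  exists (F : probability ('rV[R]_m * R)%type R) (d : 'rV[R]_m),
    [/\ integrable_requests F /\ no_point_mass F,
        nonneg d,
        ~ primal_stability F d,
        ~ strict_complementary_slackness F d &
        (exists lam, ce_rule F lam) /\
        forall lam, ce_rule F lam ->
          (fun T : nat => ce_regret F lam (T%:R *: d) T)
            =o_\oo (fun T : nat => Num.sqrt (T%:R : R))].
Proof.
case: m => // m _; exists unit_law, ones; split.
- by split; [exact: unit_law_integrable_requests|exact: unit_law_no_point_mass].
- exact: ones_nonneg.
- exact: unit_law_not_stable.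
- exact: unit_law_not_scs.
split; first by exists critical_rule; exact: critical_rule_ce.
move=> lam ce; rewrite (_ : (fun T => _) = fun=> 0); last first.
  by apply/funext => T; exact: ce_regret_eq0.
by apply/eqoP => eps eps0; apply: nearW => T; rewrite normr0 mulr_ge0// ltW.
Qed.
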